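(* Let $\mu\ge0$, $s>0$ with $\mu s<1$, let $f:\mathbb{R}^n\to\mathbb{R}$ be continuously differentiable, $\mu$-strongly convex (possibly $\mu=0$) and $(1/s)$-smooth, and let $x_0=z_0\in\mathbb{R}^n$. (i) For $\mathbf{t}_0>0$, the adaptive timestep scheme started with $\mathbf{t}_0$ is equivalent to (generates the same iterates $x_k,y_k,z_k$ as) the original NAG with $\gamma_0=\frac{4}{\mathbf{t}_0^2}\operatorname{cothc}^2\left(\frac{\sqrt\mu}{2}\mathbf{t}_0\right)>\mu$. Moreover, the sequences $\gamma_k$ and $\alpha_k$ in the original NAG can then be written as $$\gamma_k=\frac{4}{\mathbf{t}_k^2}\operatorname{cothc}^2\left(\frac{\sqrt\mu}{2}\mathbf{t}_k\right),\qquad \alpha_k=\frac{2\sqrt s}{\mathbf{t}_{k+1}}\operatorname{cothc}\left(\frac{\sqrt\mu}{2}\mathbf{t}_{k+1}\right)\qquad(k\ge0).$$ (ii) Conversely, the original NAG with $\gamma_0>\mu$ is equivalent to the adaptive timestep scheme in which $\mathbf{t}_0>0$ satisfies $\gamma_0=\frac{4}{\mathbf{t}_0^2}\operatorname{cothc}^2\left(\frac{\sqrt\mu}{2}\mathbf{t}_0\right)$.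
   Context: $\operatorname{sinhc}(x)=\sinh(x)/x$ for $x\ne0$, $\operatorname{sinhc}(0)=1$; $\operatorname{tanhc}(x)=\operatorname{sinhc}(x)/\cosh(x)$; $\operatorname{cothc}(x)=1/\operatorname{tanhc}(x)$. $f$ is $\mu$-strongly convex if $f(y)\ge f(x)+\langle\nabla f(x),y-x\rangle+\frac{\mu}{2}\|y-x\|^2$ for all $x,y$; $f$ is $L$-smooth if $\nabla f$ is $L$-Lipschitz. Adaptive timestep scheme: given $\mathbf{t}_0>0$, for $k\ge0$ let $\mathbf{t}_{k+1}$ be the largest real number $t$ satisfying $$\left(1-\frac{2\sqrt s}{t}\operatorname{cothc}\left(\frac{\sqrt\mu}{2}t\right)\right)\frac{t^2}{4}\operatorname{sinhc}^2\left(\frac{\sqrt\mu}{2}t\right)\le\frac{\mathbf{t}_k^2}{4}\operatorname{sinhc}^2\left(\frac{\sqrt\mu}{2}\mathbf{t}_k\right),$$ and iterate $$y_k=x_k+\frac{\frac{2\sqrt s}{\mathbf{t}_{k+1}}\operatorname{cothc}\left(\frac{\sqrt\mu}{2}\mathbf{t}_{k+1}\right)-\mu s}{1-\mu s}(z_k-x_k),\qquad x_{k+1}=y_k-s\nabla f(y_k),$$ $$z_{k+1}=z_k+\frac{\sqrt s\,\mathbf{t}_{k+1}}{2}\operatorname{tanhc}\left(\frac{\sqrt\mu}{2}\mathbf{t}_{k+1}\right)\left(\mu y_k-\mu z_k-\nabla f(y_k)\right).$$ Original NAG: given $\gamma_0>0$, for $k\ge0$ let $\alpha_k\in(0,1)$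 solve $\frac1s\alpha_k^2=(1-\alpha_k)\gamma_k+\mu\alpha_k$, and set $$\gamma_{k+1}=(1-\alpha_k)\gamma_k+\mu\alpha_k,\quad y_k=\frac{1}{\gamma_k+\mu\alpha_k}\left(\alpha_k\gamma_kz_k+\gamma_{k+1}x_k\right),\quad x_{k+1}=y_k-s\nabla f(y_k),$$ $$z_{k+1}=\frac{1}{\gamma_{k+1}}\left((1-\alpha_k)\gamma_kz_k+\mu\alpha_ky_k-\alpha_k\nabla f(y_k)\right).$$ *)

(* Defs.v *)
From HB Require Import structures.
From mathcomp Require Import all_boot all_order all_algebra.
From mathcomp Require Import all_classical all_reals all_analysis.

Set Implicit Arguments.
Unset Strict Implicit.
Unset Printing Implicit Defensive.

Import Order.TTheory GRing.Theory Num.Theory.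
Import numFieldNormedType.Exports.

Local Open Scope classical_set_scope.
Local Open Scope ring_scope.

Section HyperbolicFunctions.
Context {R : realType}.
Implicit Type x : R.

Definition sinh x : R := (expR x - expR (- x)) / 2.
Definition cosh x : R := (expR x + expR (- x)) / 2.

Definition sinhc x : R := if x == 0 then 1 else sinh x / x.
Definition tanhc x : R := sinhc x / cosh x.
Definition cothc x : R := 1 / tanhc x.

End HyperbolicFunctions.

(* The library's norm on ['rV[R]_n] is the sup norm, so the Euclidean norm is
   defined here; both induce the same topology, hence the same notions of
   differentiability and continuity. *)
Section Euclidean.
Context {R : realType} {n : nat}.
Implicit Types (u v : 'rV[R]_n) (f : 'rV[R]_n -> R).

Definition inner u v : R := \sum_i u 0 i * v 0 i.
Definition enorm u : R := Num.sqrt (inner u u).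

Definition grad f (x : 'rV[R]_n) : 'rV[R]_n :=
  \row_i 'D_(delta_mx 0 i) f x.

Definition continuously_differentiable f : Prop :=
  (forall x, differentiable f x) /\ continuous (grad f).

Definition strongly_convex (mu : R) f : Prop :=
  forall x y,
    f y >= f x + inner (grad f x) (y - x) + mu / 2 * enorm (y - x) ^+ 2.

Definition smooth (L : R) f : Prop :=
  forall x y, enorm (grad f x - grad f y) <= L * enorm (x - y).

End Euclidean.

Section Schemes.
Context {R : realType} {n : nat}.
Variables (mu s : R) (f : 'rV[R]_n -> R).
Implicit Types (t gamma alpha : nat -> R) (x y z : nat -> 'rV[R]_n).

(* [t = 0] is excluded because of the division by [t]; negative [t] are
   candidates. *)
Definition timestep_candidates (tk : R) : set R :=
  [set t | t != 0 /\
    (1 - 2 * Num.sqrt s / t * cothc (Num.sqrt mu / 2 * t))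
      * (t ^+ 2 / 4) * sinhc (Num.sqrt mu / 2 * t) ^+ 2
    <= tk ^+ 2 / 4 * sinhc (Num.sqrt mu / 2 * tk) ^+ 2].

Definition largest (A : set R) (a : R) : Prop := A a /\ ubound A a.

Definition adaptive_scheme (t0 : R) (x0 z0 : 'rV[R]_n) t x y z : Prop :=
  [/\ t 0%N = t0, x 0%N = x0, z 0%N = z0 &
  forall k,
    [/\ largest (timestep_candidates (t k)) (t k.+1),
        y k = x k
          + ((2 * Num.sqrt s / t k.+1 * cothc (Num.sqrt mu / 2 * t k.+1)
              - mu * s) / (1 - mu * s)) *: (z k - x k),
        x k.+1 = y k - s *: grad f (y k) &
        z k.+1 = z k
          + (Num.sqrt s * t k.+1 / 2 * tanhc (Num.sqrt mu / 2 * t k.+1))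
            *: (mu *: y k - mu *: z k - grad f (y k))]].

Definition original_NAG (gamma0 : R) (x0 z0 : 'rV[R]_n)
    gamma alpha x y z : Prop :=
  [/\ gamma 0%N = gamma0, x 0%N = x0, z 0%N = z0 &
  forall k,
    [/\ 0 < alpha k < 1 /\
          1 / s * alpha k ^+ 2 = (1 - alpha k) * gamma k + mu * alpha k,
        gamma k.+1 = (1 - alpha k) * gamma k + mu * alpha k,
        y k = (1 / (gamma k + mu * alpha k))
          *: ((alpha k * gamma k) *: z k + gamma k.+1 *: x k),
        x k.+1 = y k - s *: grad f (y k) &
        z k.+1 = (1 / gamma k.+1)
          *: (((1 - alpha k) * gamma k) *: z k + (mu * alpha k) *: y k
              - alpha k *: grad f (y k))]].

(* Each scheme defines its sequences implicitly (a largest real, a root in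
   (0, 1)), so equivalence includes that both can be run; uniqueness of the
   iterates of each scheme follows from the last clause. *)
Definition equivalent_schemes (t0 gamma0 : R) (x0 z0 : 'rV[R]_n) : Prop :=
  [/\ exists t x y z, adaptive_scheme t0 x0 z0 t x y z,
      exists gamma alpha x y z, original_NAG gamma0 x0 z0 gamma alpha x y z &
      forall t x y z gamma alpha x' y' z',
        adaptive_scheme t0 x0 z0 t x y z ->
        original_NAG gamma0 x0 z0 gamma alpha x' y' z' ->
        forall k, [/\ x k = x' k, y k = y' k & z k = z' k]].

End Schemes.

(* Main.v *)
Require Import Defs.
From mathcomp Require Import all_boot all_order all_algebra.
From mathcomp Require Import all_classical all_reals all_analysis.
Import Order.TTheory GRing.Theory Num.Theory.
Import numFieldNormedType.Exports.
From mathcomp Require Import ring lra.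
Local Open Scope ring_scope.

(** Put C(t) = (2 / t) cothc(sqrt mu t / 2) and
    S(t) = (t / 2) sinhc(sqrt mu t / 2), called [rate] and [half_sinhc] below.
    Then C S = cosh(sqrt mu t / 2) and sqrt mu S = sinh(sqrt mu t / 2), for
    mu = 0 as well, so cosh^2 - sinh^2 = 1 becomes S^2 = 1 / (C^2 - mu)
    ([half_sinhc_sqr]).  For mu > 0, C(t) = sqrt mu coth(sqrt mu t / 2), and
    for mu = 0, C(t) = 2 / t; in both cases C is a decreasing bijection from
    (0, oo) to (sqrt mu, oo) ([rate_gt_sqrt], [rate_decr], [rate_onto]).

    With gamma = C(t_k)^2 and a = sqrt s C(t), the inequality that defines the
    timesteps reads (1 - a) / (C(t)^2 - mu) <= 1 / (gamma - mu), that is,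
    (1 - a) gamma + mu a <= a^2 / s ([candidateE]).  For a > 0 this says that
    a is at least the positive root alpha_k of the equation defining alpha_k.
    As C decreases, the largest t is the one with sqrt s C(t) = alpha_k
    ([largest_timestep]), and then C(t)^2 = alpha_k^2 / s = gamma_{k+1}.

    Given this correspondence, the updates of x, y and z are the same rational
    expressions modulo the equation of alpha_k.  Hence an original run, together
    with timesteps such that C(t_k)^2 = gamma_k, is an adaptive run
    ([NAG_adaptive]).  Such timesteps exist because gamma_k > mu persists, and
    an original run exists because each quadratic has a root in (0, 1)
    ([NAG_exists]); so both schemes can be run.  Since a set has at most one
    largest element, adaptive runs are unique ([adaptive_unique]), so every
    adaptive run coincides with the one obtained from any given original
    run. *)

(** * The correspondence between timesteps and the numbers gamma *)

Section Rate.

Set Implicit Arguments.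
Unset Strict Implicit.

Context {R : realType}.
Variable mu : R.
Hypothesis mu_ge0 : 0 <= mu.
Implicit Types t c g : R.

Local Notation m := (Num.sqrt mu).

(** This is the square root of the gamma corresponding to the timestep [t]. *)
Definition rate t : R := 2 / t * cothc (m / 2 * t).
Definition half_sinhc t : R := t / 2 * sinhc (m / 2 * t).

Lemma cosh_gt0 (u : R) : 0 < cosh u.
Proof. by rewrite divr_gt0 // addr_gt0 // expR_gt0. Qed.

Lemma cosh2_sub_sinh2 (u : R) : cosh u ^+ 2 - sinh u ^+ 2 = 1.
Proof.
have e : expR u * expR (- u) = 1 by rewrite expRN divff // gt_eqF ?expR_gt0.
by rewrite /cosh /sinh -[RHS]e; field.
Qed.

Lemma sinh_incr (u v : R) : u < v -> sinh u < sinh v.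
Proof.
move=> uv; rewrite /sinh ltr_pM2r ?invr_gt0 //.
by rewrite ltrB // ltr_expR // ltrN2.
Qed.

Lemma sinh0 : sinh (0 : R) = 0.
Proof. by rewrite /sinh oppr0 subrr mul0r. Qed.

Lemma sinhc_gt0 (u : R) : 0 < sinhc u.
Proof.
rewrite /sinhc; case: eqVneq => // u0.
have [up|un|u_eq] := ltgtP u 0; last by rewrite u_eq eqxx in u0.
- by rewrite nmulr_rgt0 ?invr_lt0 // -sinh0 sinh_incr.
- by rewrite divr_gt0 // -sinh0 sinh_incr.
Qed.

(** This holds for [mu = 0] too, both sides being zero; it spares most of the
    later proofs a case distinction on [mu]. *)
Lemma sqrt_half_sinhc t : m * half_sinhc t = sinh (m / 2 * t).
Proof.
rewrite /half_sinhc /sinhc; case: eqVneq => [e|ne].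
  by rewrite e sinh0 mulr1 -[RHS]e; ring.
have [m0 t0] : m != 0 /\ t != 0.
  by move: ne; rewrite !mulf_eq0 !negb_or => /andP[/andP[]].
by field; rewrite m0 t0.
Qed.

Lemma half_sinhc_gt0 t : 0 < t -> 0 < half_sinhc t.
Proof. by move=> t0; rewrite mulr_gt0 ?divr_gt0 ?sinhc_gt0. Qed.

Lemma half_sinhc_neq0 t : t != 0 -> half_sinhc t != 0.
Proof. by move=> t0; rewrite !mulf_neq0 ?invr_neq0 // gt_eqF // sinhc_gt0. Qed.

Lemma half_sinhc_incr t u : t < u -> half_sinhc t < half_sinhc u.
Proof.
move=> tu; have := sqrtr_ge0 mu; rewrite le_eqVlt => /predU1P[m0|m0].
  by rewrite /half_sinhc -m0 !mul0r /sinhc eqxx !mulr1; lra.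
by rewrite -(ltr_pM2l m0) !sqrt_half_sinhc sinh_incr // ltr_pM2l ?divr_gt0.
Qed.

Lemma rate_cosh t : t != 0 -> rate t = cosh (m / 2 * t) / half_sinhc t.
Proof.
move=> t0; rewrite /rate /half_sinhc /cothc /tanhc.
have := gt_eqF (sinhc_gt0 (m / 2 * t)); have := gt_eqF (cosh_gt0 (m / 2 * t)).
by move=> /negbT c0 /negbT s0; field; rewrite t0 c0 s0.
Qed.

Lemma half_tanhcE t : t / 2 * tanhc (m / 2 * t) = (rate t)^-1.
Proof. by rewrite /rate /cothc div1r invfM invf_div invrK. Qed.

(** This is [cosh^2 - sinh^2 = 1] divided by [half_sinhc t ^+ 2].  It turns
    the two sides of the timestep inequality into functions of the rates. *)
Lemma half_sinhc_sqr t : t != 0 -> half_sinhc t ^+ 2 = (rate t ^+ 2 - mu)^-1.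
Proof.
move=> t0; have s0 := half_sinhc_neq0 t0.
have mE : mu = (sinh (m / 2 * t) / half_sinhc t) ^+ 2.
  by rewrite -sqrt_half_sinhc mulfK // sqr_sqrtr.
apply: (canRL (@invrK _)); rewrite rate_cosh // [X in _ - X]mE.
rewrite (expr_div_n (cosh _)) (expr_div_n (sinh _)) -mulrBl.
by rewrite cosh2_sub_sinh2 mul1r.
Qed.

(** After multiplication by [half_sinhc t] this is [sinh < cosh]. *)
Lemma rate_gt_sqrt t : 0 < t -> m < rate t.
Proof.
move=> t0; rewrite rate_cosh ?gt_eqF // ltr_pdivlMr ?half_sinhc_gt0 //.
rewrite sqrt_half_sinhc -subr_gt0.
have -> : cosh (m / 2 * t) - sinh (m / 2 * t) = expR (- (m / 2 * t)).
  by rewrite /cosh /sinh; field.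
exact: expR_gt0.
Qed.

Lemma rate_gt0 t : 0 < t -> 0 < rate t.
Proof. by move=> t0; apply: le_lt_trans (sqrtr_ge0 _) (rate_gt_sqrt t0). Qed.

Lemma rate_sqr_gt t : 0 < t -> mu < rate t ^+ 2.
Proof.
move=> t0; rewrite -[ltLHS]sqr_sqrtr // ltr_pXn2r ?nnegrE ?sqrtr_ge0 //.
  exact: rate_gt_sqrt.
exact/ltW/rate_gt0.
Qed.

(** Since [rate t ^+ 2 - mu] is the inverse square of the increasing function
    [half_sinhc]. *)
Lemma rate_decr t u : 0 < t -> t < u -> rate u < rate t.
Proof.
move=> t0 tu; have u0 := lt_trans t0 tu.
rewrite -(@ltr_pXn2r _ 2) ?nnegrE ?ltW ?rate_gt0 //.
rewrite -(ltrD2r (- mu)) -ltf_pV2 ?posrE ?subr_gt0 ?rate_sqr_gt //.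
rewrite -!half_sinhc_sqr ?gt_eqF //.
by rewrite ltr_pXn2r ?nnegrE ?ltW ?half_sinhc_gt0 // half_sinhc_incr.
Qed.

(** For [mu > 0], solving [m * coth (m * t / 2) = c] gives
    [expR (m * t) = (c + m) / (c - m)]. *)
Lemma rate_onto c : m < c -> exists2 t, 0 < t & rate t = c.
Proof.
move=> mc; have := sqrtr_ge0 mu; rewrite le_eqVlt => /predU1P[m0|m0].
  have c0 : 0 < c by rewrite m0.
  exists (2 / c); first by rewrite divr_gt0.
  rewrite rate_cosh ?gt_eqF ?divr_gt0 // /half_sinhc -m0 !mul0r /sinhc eqxx.
  by rewrite /cosh oppr0 expR0; field; rewrite gt_eqF.
have cm0 : 0 < c - m by rewrite subr_gt0.
have cp0 : 0 < c + m by lra.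
have q1 : 1 < (c + m) / (c - m) by rewrite ltr_pdivlMr //; lra.
set q := (c + m) / (c - m) in q1.
have q0 : 0 < q by lra.
pose t := ln q / m; have t0 : 0 < t by rewrite divr_gt0 // ln_gt0.
exists t => //.
set E := expR (m / 2 * t).
have E0 : E != 0 by rewrite gt_eqF ?expR_gt0.
have E2 : E ^+ 2 = q.
  rewrite expr2 -expRD -[RHS](lnK q0); congr expR.
  by rewrite /t; field; rewrite gt_eqF.
have S0 := half_sinhc_gt0 t0.
suff e : cosh (m / 2 * t) = c * half_sinhc t.
  by rewrite rate_cosh ?gt_eqF // e mulfK // gt_eqF.
apply: (mulfI (lt0r_neq0 m0)).
rewrite [RHS]mulrCA sqrt_half_sinhc /cosh /sinh expRN -/E.
apply: (mulIf E0).
transitivity (m * (E ^+ 2 + 1) / 2); first by field.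
transitivity (c * (E ^+ 2 - 1) / 2); last by field.
by rewrite E2 /q; field; rewrite gt_eqF.
Qed.

Lemma rate_sqr_onto g : mu < g -> exists t, 0 < t /\ g = rate t ^+ 2.
Proof.
move=> mug; have g0 : 0 < g by apply: le_lt_trans mug.
have [|t t0 tE] := @rate_onto (Num.sqrt g); first by rewrite ltr_sqrt.
by exists t; rewrite tE sqr_sqrtr // ltW.
Qed.

End Rate.

(** * The largest timestep and the quadratic equation *)

Section Schemes.

Set Implicit Arguments.
Unset Strict Implicit.

Context {R : realType} {n : nat}.
Variables (mu s : R) (f : 'rV[R]_n -> R).
Hypotheses (mu_ge0 : 0 <= mu) (s_gt0 : 0 < s) (mus_lt1 : mu * s < 1).
Implicit Types (g a b : R).

Definition NAG_root g a := 1 / s * a ^+ 2 = (1 - a) * g + mu * a.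

Lemma NAG_root_exists g : mu < g -> exists2 a, 0 < a < 1 & NAG_root g a.
Proof.
move=> mug; have g0 : 0 < g by apply: le_lt_trans mug.
(* Times [s], the equation is [a^2 + b a - s g = 0], with root [(r - b) / 2],
   where [r^2] is the discriminant. *)
pose b := s * (g - mu); have b0 : 0 < b by rewrite mulr_gt0 // subr_gt0.
have sg0 : 0 < s * g by rewrite mulr_gt0.
have d0 : 0 <= b ^+ 2 + 4 * (s * g).
  by rewrite addr_ge0 ?sqr_ge0 // mulr_ge0 // ltW.
pose r := Num.sqrt (b ^+ 2 + 4 * (s * g)).
have r2 : r ^+ 2 = b ^+ 2 + 4 * (s * g) by rewrite sqr_sqrtr.
have r0 : 0 <= r by exact: sqrtr_ge0.
have br : b < r by rewrite -(@ltr_pXn2r _ 2) ?nnegrE ?(ltW b0) // r2; lra.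
have rb : r < b + 2.
  rewrite -(@ltr_pXn2r _ 2) ?nnegrE ?addr_ge0 ?(ltW b0) // r2 sqrrD.
  (* The root is less than 1 precisely because [mu * s < 1]. *)
  have : s * g < 1 + b.
    rewrite -subr_gt0; have -> : 1 + b - s * g = 1 - mu * s by rewrite /b; ring.
    by rewrite subr_gt0.
  lra.
exists ((r - b) / 2); first by apply/andP; split; lra.
rewrite /NAG_root; apply: (mulfI (lt0r_neq0 s_gt0)).
have -> : s * (1 / s * ((r - b) / 2) ^+ 2) = (r ^+ 2 + b ^+ 2 - 2 * r * b) / 4.
  by field; rewrite gt_eqF.
by rewrite r2 /b; field.
Qed.

(** The difference of the two sides of the equation increases on the positive
    reals, as [mu < g], and it vanishes at [a]. *)
Lemma NAG_root_le g a b : mu < g -> 0 < b -> NAG_root g a ->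
  (1 - b) * g + mu * b <= 1 / s * b ^+ 2 -> a <= b.
Proof.
move=> mug b0 ga gb; rewrite leNgt; apply/negP => ba.
have ab : 0 < a - b by rewrite subr_gt0.
have h1 : 0 < (a - b) * (g - mu) by rewrite mulr_gt0 // subr_gt0.
have h2 : 0 < 1 / s * ((a - b) * (a + b)).
  by rewrite mulr_gt0 ?divr_gt0 // mulr_gt0 // addr_gt0 // (lt_trans b0).
have e : 1 / s * ((a - b) * (a + b)) = 1 / s * a ^+ 2 - 1 / s * b ^+ 2 by ring.
by move: h2; rewrite e ga; lra.
Qed.

(** The timestep inequality is the quadratic one in [sqrt s * rate t], since
    each side of it contains a factor [half_sinhc _ ^+ 2]. *)
Lemma candidateE (tk t : R) : 0 < tk -> 0 < t ->
  let b := Num.sqrt s * rate mu t in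
  timestep_candidates mu s tk t <->
  (1 - b) * rate mu tk ^+ 2 + mu * b <= 1 / s * b ^+ 2.
Proof.
move=> tk0 t0 b; set g := rate mu tk ^+ 2.
have g0 : 0 < g - mu by rewrite subr_gt0 rate_sqr_gt.
have h0 : 0 < rate mu t ^+ 2 - mu by rewrite subr_gt0 rate_sqr_gt.
have Sq u :
    u ^+ 2 / 4 * sinhc (Num.sqrt mu / 2 * u) ^+ 2 = half_sinhc mu u ^+ 2.
  by rewrite /half_sinhc; field.
have -> : 1 / s * b ^+ 2 = rate mu t ^+ 2.
  by rewrite /b exprMn sqr_sqrtr ?ltW // mulrA mul1r mulVf ?mul1r ?gt_eqF.
have bE : 2 * Num.sqrt s / t * cothc (Num.sqrt mu / 2 * t) = b.
  by rewrite /b /rate; ring.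
have -> : timestep_candidates mu s tk t <->
    (1 - b) / (rate mu t ^+ 2 - mu) <= (g - mu)^-1.
  rewrite /timestep_candidates /= bE -mulrA !Sq !half_sinhc_sqr ?gt_eqF //.
  by split=> [[]|].
rewrite ler_pdivrMr // mulrC ler_pdivlMr //.
by split; lra.
Qed.

(** The candidates are the positive [u] with [a <= sqrt s * rate u], an initial
    segment of the positive reals because [rate] decreases, and possibly some
    negative numbers, which do not affect the largest one. *)
Lemma largest_timestep (tk t : R) a : 0 < tk -> 0 < t ->
  NAG_root (rate mu tk ^+ 2) a -> Num.sqrt s * rate mu t = a ->
  largest (timestep_candidates mu s tk) t.
Proof.
move=> tk0 t0 ra ta; split.
  by apply/candidateE => //; rewrite ta ra.
move=> u cu; have [u0|u0] := leP u 0; first exact: le_trans u0 (ltW t0).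
rewrite leNgt; apply/negP => tu.
have := rate_decr mu_ge0 t0 tu; apply/negP; rewrite -leNgt.
have ss0 : 0 < Num.sqrt s by rewrite sqrtr_gt0.
rewrite -(ler_pM2l ss0) ta.
apply: NAG_root_le ra _; first exact: rate_sqr_gt.
- by rewrite mulr_gt0 ?rate_gt0.
- by apply/candidateE.
Qed.

Lemma largest_unique (A : set R) a b : largest A a -> largest A b -> a = b.
Proof. by move=> [Aa ubA] [Ab ubB]; apply/eqP; rewrite eq_le ubA ?ubB. Qed.

(** * Runs of the two schemes *)

(** The recursion gives [gamma k.+1 - mu = (1 - alpha k) * (gamma k - mu)]. *)
Lemma NAG_gamma_gt gamma0 x0 z0 gamma alpha x y z : mu < gamma0 ->
  original_NAG mu s f gamma0 x0 z0 gamma alpha x y z ->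
  forall k, mu < gamma k.
Proof.
move=> mug [g0 _ _ run]; elim=> [|k IHk]; first by rewrite g0.
have [[/andP[_ a1] _] -> _ _ _] := run k.
rewrite -subr_gt0.
have -> : (1 - alpha k) * gamma k + mu * alpha k - mu =
          (1 - alpha k) * (gamma k - mu) by ring.
by rewrite mulr_gt0 ?subr_gt0.
Qed.

Lemma NAG_exists gamma0 x0 z0 : mu < gamma0 ->
  exists gamma alpha x y z, original_NAG mu s f gamma0 x0 z0 gamma alpha x y z.
Proof.
move=> mug.
(* The state of the recursion is the triple [(gamma, x, z)]; [A] picks a root,
   and [S k] is the state after [k] steps. *)
have /choice[A hA] : forall g, exists a, mu < g -> 0 < a < 1 /\ NAG_root g a.
  move=> g; have [/NAG_root_exists[a a01 ra]|_] := ltP mu g; last by exists 0.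
  by exists a.
pose G g := (1 - A g) * g + mu * A g.
pose Y (p : R * 'rV[R]_n * 'rV[R]_n) :=
  (1 / (p.1.1 + mu * A p.1.1))
    *: ((A p.1.1 * p.1.1) *: p.2 + G p.1.1 *: p.1.2).
pose step (p : R * 'rV[R]_n * 'rV[R]_n) :=
  (G p.1.1, Y p - s *: grad f (Y p),
   (1 / G p.1.1) *: (((1 - A p.1.1) * p.1.1) *: p.2
     + (mu * A p.1.1) *: Y p - A p.1.1 *: grad f (Y p))).
pose S k := iter k step (gamma0, x0, z0).
have Sgt k : mu < (S k).1.1.
  elim: k => [//|k IHk]; have [/andP[_ a1] _] := hA _ IHk.
  rewrite [S _]/= /= -subr_gt0.
  have -> : G (S k).1.1 - mu = (1 - A (S k).1.1) * ((S k).1.1 - mu).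
    by rewrite /G; ring.
  by rewrite mulr_gt0 ?subr_gt0.
exists (fun k => (S k).1.1), (fun k => A (S k).1.1), (fun k => (S k).1.2),
  (fun k => Y (S k)), (fun k => (S k).2).
by split=> // k; split=> //; exact: hA.
Qed.

Lemma NAG_alphaE (t : R) a : 0 < t -> 0 < a ->
  1 / s * a ^+ 2 = rate mu t ^+ 2 ->
  Num.sqrt s * rate mu t = a.
Proof.
move=> t0 a0 e; have r0 := rate_gt0 mu t0.
have b0 : 0 <= Num.sqrt s * rate mu t by rewrite mulr_ge0 ?sqrtr_ge0 // ltW.
apply/eqP; rewrite -(@eqrXn2 _ 2) ?(ltW a0) //; apply/eqP.
by rewrite exprMn -e (sqr_sqrtr (ltW s_gt0)); field; rewrite gt_eqF.
Qed.

(** With [alpha k = sqrt s * rate (t k.+1)], the updates of [y] agree because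
    [(a - mu s) / (1 - mu s) = a g / (g + mu a)] follows from the equation of
    [a], and those of [z] because both step lengths are [s / a]. *)
Lemma NAG_adaptive t0 gamma0 x0 z0 (t : nat -> R) gamma alpha x y z :
  (forall k, 0 < t k) -> (forall k, gamma k = rate mu (t k) ^+ 2) ->
  t 0%N = t0 -> original_NAG mu s f gamma0 x0 z0 gamma alpha x y z ->
  adaptive_scheme mu s f t0 x0 z0 t x y z.
Proof.
move=> tgt0 gE t0E [_ x0E z0E run]; split=> // k.
have [[/andP[a0 a1] ra] gS yE xE zE] := run k.
set a := alpha k in a0 a1 ra gS yE zE *; set g := gamma k in ra gS yE zE *.
have g'E : 1 / s * a ^+ 2 = gamma k.+1 by rewrite gS.
have aE : Num.sqrt s * rate mu (t k.+1) = a.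
  by apply: NAG_alphaE; rewrite // -gE.
have g0 : 0 < g by rewrite /g gE exprn_gt0 ?rate_gt0.
have d0 : 0 < g + mu * a by rewrite ltr_pwDl // mulr_ge0 // ltW.
split=> //.
- by apply: largest_timestep aE; rewrite // -gE.
- have -> : 2 * Num.sqrt s / t k.+1 * cothc (Num.sqrt mu / 2 * t k.+1) = a.
    by rewrite -aE /rate; ring.
  have -> : (a - mu * s) / (1 - mu * s) = a * g / (g + mu * a).
    have d1 : 1 - mu * s != 0 by rewrite gt_eqF // subr_gt0.
    apply/eqP; rewrite eqr_div ?(lt0r_neq0 d0) //; apply/eqP.
    have a2 : a ^+ 2 = s * ((1 - a) * g + mu * a).
      by rewrite -ra; field; rewrite gt_eqF.
    transitivity (a * g + mu * a ^+ 2 - mu * s * g - mu ^+ 2 * s * a).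
      by ring.
    by rewrite a2; ring.
  rewrite yE gS; apply/rowP => i; rewrite !mxE; field.
  by rewrite gt_eqF.
- have -> : Num.sqrt s * t k.+1 / 2 * tanhc (Num.sqrt mu / 2 * t k.+1)
      = a / gamma k.+1.
    transitivity (Num.sqrt s * (t k.+1 / 2 * tanhc (Num.sqrt mu / 2 * t k.+1))).
      by ring.
    by rewrite half_tanhcE gE -aE; field; rewrite gt_eqF // rate_gt0.
  rewrite zE; apply/rowP => i; rewrite !mxE gS; field.
  by rewrite -gS gE gt_eqF // exprn_gt0 ?rate_gt0.
Qed.

Lemma NAG_timesteps t0 x0 z0 gamma alpha x y z : 0 < t0 ->
  original_NAG mu s f (rate mu t0 ^+ 2) x0 z0 gamma alpha x y z ->
  exists t : nat -> R,
    [/\ forall k, 0 < t k, forall k, gamma k = rate mu (t k) ^+ 2 &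
        t 0%N = t0].
Proof.
move=> t0_gt0 run.
have /choice[t ht] k : exists u, 0 < u /\ gamma k = rate mu u ^+ 2.
  have := NAG_gamma_gt (rate_sqr_gt mu_ge0 t0_gt0) run k.
  exact: rate_sqr_onto.
have g0 : gamma 0%N = rate mu t0 ^+ 2 by case: run.
exists (fun k => if k is 0%N then t0 else t k).
by split=> // -[|k] //; have [] := ht k.+1.
Qed.

(** Uniqueness of the largest element determines each timestep from the one
    before; everything else in the scheme is explicit. *)
Lemma adaptive_unique t0 x0 z0 (t : nat -> R) x y z t' x' y' z' :
  adaptive_scheme mu s f t0 x0 z0 t x y z ->
  adaptive_scheme mu s f t0 x0 z0 t' x' y' z' ->
  forall k, [/\ t k = t' k, x k = x' k, y k = y' k & z k = z' k].
Proof.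
move=> [t0E x0E z0E run] [t0E' x0E' z0E' run'].
have tS k : t k = t' k -> t k.+1 = t' k.+1.
  move=> e; have [tk _ _ _] := run k; have [tk' _ _ _] := run' k.
  by apply: largest_unique tk _; rewrite e.
have yS k : t k = t' k -> x k = x' k -> z k = z' k -> y k = y' k.
  move=> et ex ez; have [_ -> _ _] := run k; have [_ -> _ _] := run' k.
  by rewrite (tS _ et) ex ez.
have txz k : [/\ t k = t' k, x k = x' k & z k = z' k].
  elim: k => [|k [et ex ez]]; first by split; congruence.
  have ey := yS _ et ex ez; have et' := tS _ et.
  have [_ _ -> ->] := run k; have [_ _ -> ->] := run' k.
  by rewrite et' ey ez.
by move=> k; have [et ex ez] := txz k; split=> //; apply: yS.
Qed.

(** The original run is itself an adaptive run for suitable timesteps, so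
    uniqueness of adaptive runs identifies it with the given one. *)
Lemma schemes_agree t0 x0 z0 (t : nat -> R) x y z gamma alpha x' y' z' :
  0 < t0 ->
  adaptive_scheme mu s f t0 x0 z0 t x y z ->
  original_NAG mu s f (rate mu t0 ^+ 2) x0 z0 gamma alpha x' y' z' ->
  forall k, [/\ x k = x' k, y k = y' k, z k = z' k,
    gamma k = rate mu (t k) ^+ 2 & alpha k = Num.sqrt s * rate mu (t k.+1)].
Proof.
move=> t0_gt0 arun nrun k.
have [u [u_gt0 uE u0]] := NAG_timesteps t0_gt0 nrun.
have eqs := adaptive_unique arun (NAG_adaptive u_gt0 uE u0 nrun).
have [-> -> -> ->] := eqs k; have [-> _ _ _] := eqs k.+1.
have [_ _ _ /(_ k)[[/andP[a0 _] ra] gS _ _ _]] := nrun.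
by split=> //; rewrite (@NAG_alphaE _ (alpha k)) // ra -gS uE.
Qed.

Lemma rate_equivalent_schemes t0 x0 z0 : 0 < t0 ->
  equivalent_schemes mu s f t0 (rate mu t0 ^+ 2) x0 z0.
Proof.
move=> t0_gt0.
have nag := NAG_exists x0 z0 (rate_sqr_gt mu_ge0 t0_gt0).
split=> // [|t x y z gamma alpha x' y' z' arun nrun k].
  have [gamma [alpha [x [y [z run]]]]] := nag.
  have [t [t_gt0 tE t0E]] := NAG_timesteps t0_gt0 run.
  by exists t, x, y, z; apply: NAG_adaptive run.
by have [] := schemes_agree t0_gt0 arun nrun k.
Qed.

End Schemes.

Theorem proposition12 (R : realType) (n : nat) (mu s : R)
    (f : 'rV[R]_n -> R) (x0 z0 : 'rV[R]_n)
    (mu_ge0 : 0 <= mu) (s_gt0 : 0 < s) (mus_lt1 : mu * s < 1)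
    (f_C1 : continuously_differentiable f)
    (f_convex : strongly_convex mu f) (f_smooth : smooth (1 / s) f)
    (x0z0 : x0 = z0) :
  (forall t0 gamma0 : R, 0 < t0 ->
     gamma0 = 4 / t0 ^+ 2 * cothc (Num.sqrt mu / 2 * t0) ^+ 2 ->
     [/\ gamma0 > mu,
         equivalent_schemes mu s f t0 gamma0 x0 z0 &
         forall t x y z gamma alpha x' y' z',
           adaptive_scheme mu s f t0 x0 z0 t x y z ->
           original_NAG mu s f gamma0 x0 z0 gamma alpha x' y' z' ->
           forall k : nat,
             gamma k = 4 / t k ^+ 2 * cothc (Num.sqrt mu / 2 * t k) ^+ 2
             /\ alpha k = 2 * Num.sqrt s / t k.+1
                          * cothc (Num.sqrt mu / 2 * t k.+1)])
  /\
  (forall gamma0 : R, mu < gamma0 ->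
     (exists t0 : R, 0 < t0 /\
        gamma0 = 4 / t0 ^+ 2 * cothc (Num.sqrt mu / 2 * t0) ^+ 2)
     /\
     (forall t0 : R, 0 < t0 ->
        gamma0 = 4 / t0 ^+ 2 * cothc (Num.sqrt mu / 2 * t0) ^+ 2 ->
        equivalent_schemes mu s f t0 gamma0 x0 z0)).
Proof.
have rateE t : 4 / t ^+ 2 * cothc (Num.sqrt mu / 2 * t) ^+ 2 = rate mu t ^+ 2.
  by rewrite /rate [RHS]exprMn (expr_div_n 2 t) -natrX.
split=> [t0 gamma0 t0_gt0|gamma0 mug].
  rewrite rateE => ->; split.
  - exact: rate_sqr_gt.
  - exact: rate_equivalent_schemes.
  - move=> t x y z gamma alpha x' y' z' arun nrun k.
    have [] := schemes_agree mu_ge0 s_gt0 mus_lt1 t0_gt0 arun nrun k.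
    by rewrite rateE => _ _ _ -> ->; split=> //; rewrite /rate; ring.
split.
  by have [t0 [t0_gt0 ->]] := rate_sqr_onto mu_ge0 mug; exists t0; rewrite rateE.
by move=> t0 t0_gt0; rewrite rateE => ->; apply: rate_equivalent_schemes.
Qed.
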